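(* Let $W$ be a weighted small-step walk in the quadrant with weights $p_{ij}$ and associated group $G_W$. The group $G_W$ is of order $4$ if and only if the two matrices $$P_{00}=\begin{pmatrix} p_{11} & p_{1,-1}\\ p_{-1,1} & p_{-1,-1}\end{pmatrix},\qquad P_\infty=\begin{pmatrix} p_{11} & p_{10} & p_{1,-1}\\ p_{01} & p_{00} & p_{0,-1}\\ p_{-1,1} & p_{-1,0} & p_{-1,-1}\end{pmatrix}$$ are both singular, i.e. $\det P_{00}=\det P_\infty=0$. More explicitly, $G_W$ is of order $4$ if and only if $$P_\infty=\begin{pmatrix}\mu\rho & \alpha\rho & \nu\rho\\ p_{01} & p_{00} & p_{0,-1}\\ \mu\sigma & \alpha\sigma & \nu\sigma\end{pmatrix}\quad\text{or}\quad P_\infty=\begin{pmatrix}\mu\rho & p_{10} & \nu\rho\\ \mu\alpha & p_{00} & \nu\alpha\\ \mu\sigma & p_{-1,0} & \nu\sigma\end{pmatrix}$$ for some parameters $\alpha,\mu,\nu,\rho,\sigma$.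
   Context: A weighted small-step walk $W$ in the quadrant is given by real weights $p_{ij}\ge 0$, $i,j\in\{-1,0,1\}$, with $\sum_{i,j=-1}^{1}p_{ij}=1$. Its inventory is $$\chi_W(x,y)=\sum_{i,j=-1}^1 p_{ij}x^iy^j = xA_1(y)+B_1(y)+\frac{C_1(y)}{x}=yA_2(x)+B_2(x)+\frac{C_2(x)}{y},$$ where $A_1,B_1,C_1$ are Laurent polynomials in $y$ and $A_2,B_2,C_2$ are Laurent polynomials in $x$. It is assumed that none of $A_1,C_1,A_2,C_2$ is identically zero, so that $$\varphi_1(x,y)=\left(\frac{C_1(y)}{xA_1(y)},\,y\right),\qquad \varphi_2(x,y)=\left(x,\,\frac{C_2(x)}{yA_2(x)}\right)$$ are birational involutions of the $(x,y)$-plane. The group of $W$ is $G_W=\langle\varphi_1,\varphi_2\rangle$, the group of birational transformations of the $(x,y)$-plane generated by them. The parameters $\alpha,\mu,\nu,\rho,\sigma$ are real numbers. *)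

(* Defs.v *)
From HB Require Import structures.
From mathcomp Require Import all_boot all_order all_algebra.
From mathcomp Require Import mathcomp_extra boolp classical_sets functions cardinality.
From mathcomp Require Import reals.

Set Implicit Arguments.
Unset Strict Implicit.
Unset Printing Implicit Defensive.

Import Order.TTheory GRing.Theory Num.Theory.
Local Open Scope classical_set_scope.
Local Open Scope ring_scope.

(* The field R(x, y). As in polyXY, the outer indeterminate 'X of               *)
(* {poly {poly R}} plays the role of x and the inner one, 'Y = 'X%:P, of y.     *)
Definition ratfun (R : realType) : fieldType := {fraction {poly {poly R}}}.

Section RationalFunctions.
Variable R : realType.
Local Notation K := (ratfun R).

Definition rfC (c : R) : K := tofrac c%:P%:P.
Definition rfX : K := tofrac 'X.
Definition rfY : K := tofrac 'X%:P.

Definition rf_eval_poly (u v : K) (q : {poly {poly R}}) : K :=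
  (map_poly (map_poly rfC) q).[u%:P].[v].

(* f(u, v), computed on the representative of f chosen by the library. When     *)
(* (u, v) is dominant, as for every element of a group of birational maps, the  *)
(* denominator does not vanish at (u, v) and the value does not depend on the   *)
(* representative; otherwise it may be a junk value, since 0^-1 = 0.            *)
Definition rf_subst (u v f : K) : K :=
  rf_eval_poly u v (\n_(repr f)) / rf_eval_poly u v (\d_(repr f)).

(* A rational transformation of the plane, given by its two coordinates.        *)
Definition ratmap : Type := (K * K)%type.

Definition ratmap_id : ratmap := (rfX, rfY).

Definition ratmap_comp (g h : ratmap) : ratmap :=
  (rf_subst h.1 h.2 g.1, rf_subst h.1 h.2 g.2).

(* When all elements of S are birational, the clause gen_inv only ever adds     *)
(* genuine inverses: a dominant g has at most one two-sided inverse.            *)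
Inductive generated (S : set ratmap) : ratmap -> Prop :=
| gen_in g : S g -> generated S g
| gen_id : generated S ratmap_id
| gen_comp g h : generated S g -> generated S h ->
    generated S (ratmap_comp g h)
| gen_inv g h : generated S g ->
    ratmap_comp g h = ratmap_id -> ratmap_comp h g = ratmap_id ->
    generated S h.

End RationalFunctions.

Definition steps : seq int := [:: -1; 0; 1].

Lemma big_steps (V : zmodType) (f : int -> V) :
  \sum_(i <- steps) f i = f 1 + f 0 + f (-1).
Proof. by rewrite !big_cons big_nil addr0 addrC [f 0 + _]addrC. Qed.

Record small_step_walk (R : realType) := SmallStepWalk {
  weight :> int -> int -> R;
  weight_small : forall i j, weight i j != 0 -> (i \in steps) && (j \in steps);
  weight_ge0 : forall i j, 0 <= weight i j;
  weight_sum1 : \sum_(i <- steps) \sum_(j <- steps) weight i j = 1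
}.

Section Walks.
Variables (R : realType) (W : small_step_walk R).
Local Notation K := (ratfun R).

Definition inventory (x y : K) : K :=
  \sum_(i <- steps) \sum_(j <- steps) rfC (W i j) * x ^ i * y ^ j.

Definition A1 (y : K) : K := \sum_(j <- steps) rfC (W 1 j) * y ^ j.
Definition B1 (y : K) : K := \sum_(j <- steps) rfC (W 0 j) * y ^ j.
Definition C1 (y : K) : K := \sum_(j <- steps) rfC (W (-1) j) * y ^ j.
Definition A2 (x : K) : K := \sum_(i <- steps) rfC (W i 1) * x ^ i.
Definition B2 (x : K) : K := \sum_(i <- steps) rfC (W i 0) * x ^ i.
Definition C2 (x : K) : K := \sum_(i <- steps) rfC (W i (-1)) * x ^ i.

Lemma inventory_x (x y : K) :
  inventory x y = x * A1 y + B1 y + C1 y / x.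
Proof.
have -> : inventory x y =
    \sum_(i <- steps) x ^ i * \sum_(j <- steps) rfC (W i j) * y ^ j.
  apply: eq_bigr => i _; rewrite mulr_sumr; apply: eq_bigr => j _.
  by rewrite mulrA [x ^ i * _]mulrC.
by rewrite [LHS]big_steps expr1z expr0z exprN1 mul1r [x^-1 * _]mulrC.
Qed.

Lemma inventory_y (x y : K) :
  inventory x y = y * A2 x + B2 x + C2 x / y.
Proof.
have -> : inventory x y =
    \sum_(j <- steps) y ^ j * \sum_(i <- steps) rfC (W i j) * x ^ i.
  rewrite /inventory exchange_big; apply: eq_bigr => j _.
  by rewrite mulr_sumr; apply: eq_bigr => i _; rewrite [RHS]mulrC.
by rewrite [LHS]big_steps expr1z expr0z exprN1 mul1r [y^-1 * _]mulrC.
Qed.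

Definition nondegenerate_walk : Prop :=
  [/\ A1 (rfY R) != 0, C1 (rfY R) != 0, A2 (rfX R) != 0 & C2 (rfX R) != 0].

Definition phi1 : ratmap R :=
  (C1 (rfY R) / (rfX R * A1 (rfY R)), rfY R).

Definition phi2 : ratmap R :=
  (rfX R, C2 (rfX R) / (rfY R * A2 (rfX R))).

Definition walk_group : set (ratmap R) := generated [set phi1; phi2].

Definition walk_group_has_order (n : nat) : Prop := (walk_group #= `I_n)%card.

End Walks.

Definition mx_of_rows (R : realType) (m n : nat) (rows : seq (seq R)) : 'M[R]_(m, n) :=
  \matrix_(i < m, j < n) nth 0 (nth [::] rows i) j.

Definition P00 (R : realType) (W : small_step_walk R) : 'M[R]_2 :=
  mx_of_rows 2 2
    [:: [:: W 1 1;    W 1 (-1)];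
        [:: W (-1) 1; W (-1) (-1)]].

Definition Pinfty (R : realType) (W : small_step_walk R) : 'M[R]_3 :=
  mx_of_rows 3 3
    [:: [:: W 1 1;    W 1 0;    W 1 (-1)];
        [:: W 0 1;    W 0 0;    W 0 (-1)];
        [:: W (-1) 1; W (-1) 0; W (-1) (-1)]].

(* Main.v *)
Require Import Defs.
From HB Require Import structures.
From mathcomp Require Import all_boot all_order all_algebra.
From mathcomp Require Import generic_quotient ring finmap.
From mathcomp Require Import boolp classical_sets cardinality reals.

(** The group is generated by the two involutions phi1 and phi2, which are
    distinct and different from the identity, so it has order 4 exactly when
    they commute.  In coordinates, commutation says that the first coordinate
    of phi1 is unchanged by the substitution y -> y' = C2(x) / (y A2(x)), and
    that the second coordinate of phi2 is unchanged by
    x -> x' = C1(y) / (x A1(y)).  The two conditions are exchanged by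
    swapping x with y and transposing the weights, and each turns out to be
    equivalent to the vanishing of the two (transposition-invariant)
    determinants.

    For the first one, C1(y') / (x A1(y')) = C1(y) / (x A1(y)) means that
    C1(y') A1(y) - C1(y) A1(y') = 0.  Let D10, D1m, D0m be the 2x2 minors of
    the rows of C1 and A1.  The left-hand side is, up to a nonzero factor,
      (y' - y) (D10 y y' + D1m (y + y') + D0m).
    After y' is replaced by its value and the denominators are cleared, the
    factors become C2 - A2 y^2, which is nonzero, and
      D1m C2 + (D10 C2 + D0m A2) y + D1m A2 y^2.
    Since x and y are algebraically independent, the latter vanishes iff all
    the coefficients do: the outer two give D1m = 0, which says that P00 is
    singular.  Modulo D1m, the coefficient of D10 C2 + D0m A2 at x^i is the
    determinant of Pinfty with its middle row replaced by the row of the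
    weights p_ij.  It is zero for i = 1 and i = -1, since a row is repeated, and
    for i = 0 it is the determinant of Pinfty (lemma laurent_fixed_iff).

    Substitution is computed on chosen representatives of fractions, hence it
    is a field endomorphism only along dominant maps, those whose coordinates
    are algebraically independent.  Lemma alg_independent_div proves that phi1
    and phi2 are dominant; the pullback by a dominant map is then the extension
    of the evaluation to the field of fractions, and the composition of
    dominant maps is associative (ratmap_compA), so that the usual computations
    with involutions apply (card4_commute, commute_card4).

    The explicit form is linear algebra: a singular P00 is a product of a
    column and a row, and then the determinant of Pinfty splits into two
    factors, one for each of the two shapes (minors_eq0_factor). *)

Set Implicit Arguments.
Unset Strict Implicit.
Unset Printing Implicit Defensive.

Import GRing.Theory.
Local Open Scope ring_scope.

(** * Evaluation of bivariate polynomials and algebraic independence *)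

Section Evaluation.
Variables (A : idomainType) (F : fieldType) (f : {rmorphism A -> F}).

Definition eval1 (v : F) (p : {poly A}) : F := (map_poly f p).[v].

HB.instance Definition _ (v : F) :=
  GRing.RMorphism.copy (eval1 v) (horner_eval v \o map_poly f).

Definition eval2 (u v : F) (p : {poly {poly A}}) : F :=
  (map_poly (map_poly f) p).[u%:P].[v].

HB.instance Definition _ (u v : F) :=
  GRing.RMorphism.copy (eval2 u v)
    (horner_eval v \o horner_eval u%:P \o map_poly (map_poly f)).

Lemma eval1C (v : F) (c : A) : eval1 v c%:P = f c.
Proof. by rewrite /eval1 map_polyC hornerC. Qed.

Lemma eval1X (v : F) : eval1 v 'X = v.
Proof. by rewrite /eval1 map_polyX hornerX. Qed.

Lemma eval2C (u v : F) (p : {poly A}) : eval2 u v p%:P = eval1 v p.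
Proof. by rewrite /eval2 map_polyC /= hornerC. Qed.

Lemma eval2X (u v : F) : eval2 u v 'X = u.
Proof. by rewrite /eval2 map_polyX hornerX hornerC. Qed.

Lemma eval2E (u v : F) (p : {poly {poly A}}) :
  eval2 u v p = \sum_(i < size p) eval1 v p`_i * u ^+ i.
Proof.
rewrite -[p in LHS]coefK poly_def rmorph_sum; apply: eq_bigr => i _.
by rewrite -mul_polyC rmorphM rmorphXn /= eval2C eval2X.
Qed.

Lemma eval2_swap (u v : F) (p : {poly {poly A}}) :
  eval2 u v (swapXY p) = eval2 v u p.
Proof. by rewrite /eval2 -swapXY_map horner2_swapXY. Qed.

Lemma eval2_quadratic (u v : F) (p0 p1 p2 : {poly A}) :
  eval2 u v (p0%:P + p1%:P * 'X + p2%:P * 'X^2) =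
  eval1 v p0 + eval1 v p1 * u + eval1 v p2 * u ^+ 2.
Proof. by rewrite !rmorphD !rmorphM /= !eval2C !eval2X. Qed.

Definition alg_independent (u v : F) : Prop :=
  forall p, eval2 u v p = 0 -> p = 0.

Lemma alg_independent_swap (u v : F) :
  alg_independent u v -> alg_independent v u.
Proof.
move=> ind p p0; apply/eqP; rewrite -swapXY_eq0; apply/eqP.
by apply: ind; rewrite /= eval2_swap.
Qed.

Section Independent.
Variables x y : F.
Hypothesis ind : alg_independent x y.

Lemma eval2_eq0 p : (eval2 x y p == 0) = (p == 0).
Proof. by apply/eqP/eqP => [/ind //|->]; rewrite rmorph0. Qed.

Lemma alg_independent_neq0 : (x != 0) * (y != 0).
Proof.
split; first by rewrite -(eval2X x y) eval2_eq0 polyX_eq0.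
by rewrite -(eval1X y) -(eval2C x) eval2_eq0 polyC_eq0 polyX_eq0.
Qed.

(** If p vanishes at (c(y) / (x d(y)), y), multiplying by (x d(y))^n, where n
    bounds the degree of p, gives a relation between x and y whose coefficients
    are those of p in reverse order, times powers of c and d. *)
Lemma alg_independent_div (c d : {poly A}) :
  c != 0 -> d != 0 -> alg_independent (eval1 y c / (x * eval1 y d)) y.
Proof.
move=> c0 d0 p p0.
have x0 : x != 0 by rewrite alg_independent_neq0.
have dy0 : eval1 y d != 0 by rewrite -(eval2C x) eval2_eq0 polyC_eq0.
pose n := size p.
pose q : {poly {poly A}} := \poly_(j < n.+1) (p`_(n - j) * c ^+ (n - j) * d ^+ j).
have q0 : q = 0.
  apply: ind.
  transitivity ((x * eval1 y d) ^+ n *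
                eval2 (eval1 y c / (x * eval1 y d)) y p); last first.
    by rewrite p0 mulr0.
  rewrite (eval2E _ _ p) mulr_sumr /q poly_def rmorph_sum.
  rewrite big_ord_recl subn0 nth_default // !mul0r scale0r rmorph0 add0r.
  rewrite (reindex_inj rev_ord_inj); apply: eq_bigr => i _.
  have lt_in := ltn_ord i.
  rewrite lift0 /= subnSK // subKn; last exact: ltnW.
  rewrite -mul_polyC rmorphM rmorphXn /= eval2X eval2C !rmorphM !rmorphXn /=.
  rewrite -[n in RHS](subnK (ltnW lt_in)) exprD expr_div_n !exprMn.
  by field; rewrite !expf_neq0.
apply/polyP => i; rewrite coef0.
have [/leq_sizeP -> //|lt_in] := leqP (size p) i.
have /(congr1 (fun r : {poly {poly A}} => r`_(n - i))) := q0.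
rewrite coef0 coef_poly ltnS leq_subr subKn; last exact: ltnW.
move/eqP; rewrite !mulf_eq0 !expf_eq0 (negPf c0) (negPf d0) !andbF !orbF.
by move/eqP.
Qed.

End Independent.

End Evaluation.

(** * Laurent polynomials with exponents -1, 0, 1 *)

Definition laurent (A : idomainType) (F : fieldType) (f : {rmorphism A -> F})
    (a : int -> A) (z : F) : F :=
  \sum_(i <- steps) f (a i) * z ^ i.

Definition corner_minor (A : nzRingType) (w : int -> int -> A) : A :=
  w 1 1 * w (-1) (-1) - w 1 (-1) * w (-1) 1.

Definition full_minor (A : nzRingType) (w : int -> int -> A) : A :=
  w 1 1 * (w 0 0 * w (-1) (-1) - w 0 (-1) * w (-1) 0)
  - w 1 0 * (w 0 1 * w (-1) (-1) - w 0 (-1) * w (-1) 1)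
  + w 1 (-1) * (w 0 1 * w (-1) 0 - w 0 0 * w (-1) 1).

Lemma corner_minor_tr (A : comNzRingType) (w : int -> int -> A) :
  corner_minor (fun i j => w j i) = corner_minor w.
Proof. by rewrite /corner_minor; ring. Qed.

Lemma full_minor_tr (A : comNzRingType) (w : int -> int -> A) :
  full_minor (fun i j => w j i) = full_minor w.
Proof. by rewrite /full_minor; ring. Qed.

(** The computation behind the fact that phi1 and phi2 are involutions. *)
Lemma div_div_involutive (F : fieldType) (x a c : F) :
  x != 0 -> a != 0 -> c != 0 -> c / (c / (x * a) * a) = x.
Proof. by move=> x0 a0 c0; field; rewrite x0 a0 c0. Qed.

Section Laurent.
Variables (A : idomainType) (F : fieldType) (f : {rmorphism A -> F}).
Local Notation laurent := (laurent f).

Lemma laurentE (a : int -> A) (z : F) :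
  laurent a z = f (a 1) * z + f (a 0) + f (a (-1)) / z.
Proof. by rewrite /laurent big_steps expr1z expr0z exprN1 mulr1. Qed.

Lemma laurentZ (k : A) (a : int -> A) (z : F) :
  laurent (fun i => k * a i) z = f k * laurent a z.
Proof. by rewrite !laurentE !rmorphM; ring. Qed.

Lemma laurentD (a b : int -> A) (z : F) :
  laurent (fun i => a i + b i) z = laurent a z + laurent b z.
Proof. by rewrite !laurentE !rmorphD; ring. Qed.

Lemma endo_laurent (k : {rmorphism F -> F}) (a : int -> A) (z : F) :
  (forall c, k (f c) = f c) -> k (laurent a z) = laurent a (k z).
Proof. by move=> kf; rewrite !laurentE !rmorphD !rmorphM fmorphV !kf. Qed.

Lemma endo_laurent_div (k : {rmorphism F -> F}) (a c : int -> A) (x y : F) :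
  (forall e, k (f e) = f e) ->
  k (laurent c y / (x * laurent a y)) =
  laurent c (k y) / (k x * laurent a (k y)).
Proof. by move=> kf; rewrite fmorph_div rmorphM !endo_laurent. Qed.

(** Laurent polynomials shifted by one degree, so that the theory of
    independence of ordinary polynomials applies to them. *)
Definition laurent_poly (a : int -> A) : {poly A} :=
  (a 1)%:P * 'X^2 + (a 0)%:P * 'X + (a (-1))%:P.

Lemma eval1_laurent_poly (a : int -> A) (z : F) :
  z != 0 -> eval1 f z (laurent_poly a) = z * laurent a z.
Proof.
move=> z0; rewrite laurentE !rmorphD !rmorphM /= !eval1C !eval1X.
by field.
Qed.

Section Independent.
Variables x y : F.
Hypothesis ind : alg_independent f x y.
Let x0 : x != 0. Proof. by rewrite (alg_independent_neq0 ind). Qed.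
Let y0 : y != 0. Proof. by rewrite (alg_independent_neq0 ind). Qed.

Lemma alg_independent_laurent (a c : int -> A) :
  laurent a y != 0 -> laurent c y != 0 ->
  alg_independent f (laurent c y / (x * laurent a y)) y.
Proof.
move=> ay0 cy0.
have poly_neq0 b : laurent b y != 0 -> laurent_poly b != 0.
  apply: contra_neq => b0; apply: (mulfI y0).
  by rewrite -eval1_laurent_poly // b0 rmorph0 mulr0.
have := alg_independent_div ind (poly_neq0 _ cy0) (poly_neq0 _ ay0).
rewrite !eval1_laurent_poly //.
suff -> : y * laurent c y / (x * (y * laurent a y)) =
          laurent c y / (x * laurent a y) by [].
by field; rewrite x0 y0 ay0.
Qed.

Lemma laurent_indep (m0 m1 m2 : int -> A) :
  laurent m0 x + laurent m1 x * y + laurent m2 x * y ^+ 2 = 0 ->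
  forall i, i \in steps -> [/\ m0 i = 0, m1 i = 0 & m2 i = 0].
Proof.
move=> m_eq0.
(* Here the outer variable stands for y and the inner one for x. *)
pose P := (laurent_poly m0)%:P + (laurent_poly m1)%:P * 'X
          + (laurent_poly m2)%:P * 'X^2.
have P0 : P = 0.
  apply: (alg_independent_swap ind).
  rewrite eval2_quadratic !eval1_laurent_poly //.
  by rewrite -!mulrA -!mulrDr m_eq0 mulr0.
have coefP j : P`_j = laurent_poly m0 *+ (j == 0%N) +
     laurent_poly m1 *+ (j == 1%N) + laurent_poly m2 *+ (j == 2%N).
  rewrite !coefD !coefCM coefC coefX coefXn !mulr_natr.
  by case: j.
have m_coef i : [/\ (laurent_poly m0)`_i = 0, (laurent_poly m1)`_i = 0
                  & (laurent_poly m2)`_i = 0].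
  have := (coefP 0%N, coefP 1%N, coefP 2%N).
  rewrite P0 !coef0 /= !mulr1n !mulr0n !addr0 !add0r => -[[<- <-] <-].
  by rewrite coef0.
have coefE m : [/\ (laurent_poly m)`_0 = m (-1), (laurent_poly m)`_1 = m 0
                 & (laurent_poly m)`_2 = m 1].
  by rewrite /laurent_poly !coefD !coefCM !coefC !coefX !coefXn /=
             !mulr0 !mulr1 !addr0 !add0r.
have [E00 E01 E02] := coefE m0; have [E10 E11 E12] := coefE m1.
have [E20 E21 E22] := coefE m2.
move=> i; rewrite !inE => /or3P[] /eqP ->.
- by rewrite -E00 -E10 -E20; exact: m_coef.
- by rewrite -E01 -E11 -E21; exact: m_coef.
- by rewrite -E02 -E12 -E22; exact: m_coef.
Qed.

(** A nonzero coefficient a i would be the coefficient of a monomial in y^2,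
    which nothing in c(x) can cancel.  This makes the trivial factor y' - y of
    laurent_fixed_iff nonzero, and it also shows that phi1 and phi2 are not the
    identity. *)
Lemma laurent_square_neq (a c : int -> A) :
  laurent a x != 0 -> laurent c x - laurent a x * y ^+ 2 != 0.
Proof.
apply: contra_neq => e.
have /laurent_indep z : laurent c x + laurent (fun=> 0) x * y +
    laurent (fun i => - a i) x * y ^+ 2 = 0.
  by rewrite -[RHS]e !laurentE !rmorphN rmorph0; ring.
have a0 i : i \in steps -> a i = 0.
  by case/z => _ _ /eqP; rewrite oppr_eq0 => /eqP.
by rewrite laurentE !a0 // rmorph0 !mul0r !addr0.
Qed.

Lemma laurent_div_neq (a c : int -> A) :
  laurent a x != 0 -> laurent c x / (y * laurent a x) <> y.
Proof.
move=> ax0 e; have /eqP[] := laurent_square_neq c ax0.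
have yax0 : y * laurent a x != 0 by rewrite mulf_neq0.
by rewrite -[laurent c x](divfK yax0) e; ring.
Qed.

(** The heart of the proof: invariance of a coordinate of one involution under
    the other one.  The second involution enters only through y', so that the
    lemma serves twice, the second time with x and y exchanged and w
    transposed. *)
Lemma laurent_fixed_iff (w : int -> int -> A) :
  let a := w 1 in let c := w (-1) in
  let p := w^~ 1 in let q := w^~ (-1) in
  let y' := laurent q x / (y * laurent p x) in
  laurent p x != 0 -> laurent q x != 0 ->
  laurent a y != 0 -> laurent a y' != 0 ->
  laurent c y' / (x * laurent a y') = laurent c y / (x * laurent a y) <->
  corner_minor w = 0 /\ full_minor w = 0.
Proof.
move=> a c p q y' px0 qx0 ay0 ay'0.
(* The 2x2 minors of the rows c and a; the suffix m stands for -1. *)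
pose D10 := c 1 * a 0 - a 1 * c 0.
pose D1m := c 1 * a (-1) - a 1 * c (-1).
pose D0m := c 0 * a (-1) - a 0 * c (-1).
pose m0 i := D1m * q i; pose m2 i := D1m * p i.
pose m1 i := D10 * q i + D0m * p i.
(* This is the factorization with y' - y split off, for y' = q(x) / (y p(x)). *)
have cross : laurent c y' * laurent a y - laurent c y * laurent a y' =
  (laurent q x - laurent p x * y ^+ 2) *
  (laurent m0 x + laurent m1 x * y + laurent m2 x * y ^+ 2) /
  (laurent q x * laurent p x * y ^+ 2).
  have m0E : laurent m0 x = f D1m * laurent q x.
    exact: laurentZ.
  have m1E : laurent m1 x = f D10 * laurent q x + f D0m * laurent p x.
    by rewrite -!laurentZ -laurentD.
  have m2E : laurent m2 x = f D1m * laurent p x.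
    exact: laurentZ.
  rewrite m0E m1E m2E /D10 /D1m /D0m !rmorphB !rmorphM.
  rewrite ![laurent _ y]laurentE ![laurent _ y']laurentE /y'.
  by field; rewrite px0 qx0 y0.
have -> : laurent c y' / (x * laurent a y') = laurent c y / (x * laurent a y) <->
    laurent m0 x + laurent m1 x * y + laurent m2 x * y ^+ 2 = 0.
  have diffE : laurent c y' / (x * laurent a y') - laurent c y / (x * laurent a y)
      = (laurent c y' * laurent a y - laurent c y * laurent a y') /
        (x * laurent a y' * laurent a y).
    by field; rewrite x0 ay0 ay'0.
  split=> [/eqP|m_eq0]; last first.
    by apply/eqP; rewrite -subr_eq0 diffE cross m_eq0 mulr0 !mul0r.
  rewrite -subr_eq0 diffE cross !mulf_eq0 !invr_eq0 !mulf_eq0.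
  rewrite (negPf px0) (negPf qx0) (negPf y0) (negPf x0) (negPf ay0) (negPf ay'0).
  by rewrite !orbF (negPf (laurent_square_neq _ px0)) => /eqP.
rewrite /corner_minor /full_minor; split=> [/laurent_indep z|[corner0 full0]].
  (* All the products D1m * q i vanish, and q is not zero. *)
  have D1m0 : D1m = 0.
    apply/eqP; apply: contraNT qx0 => D1m_neq0.
    have q0 i : i \in steps -> q i = 0.
      by case/z => /eqP; rewrite mulf_eq0 (negPf D1m_neq0) => /eqP.
    by rewrite laurentE !q0 // rmorph0 !mul0r !addr0.
  have [_ m10 _] := z 0 isT.
  have corner0 : w 1 1 * w (-1) (-1) - w 1 (-1) * w (-1) 1 = 0.
    by apply: oppr_inj; rewrite oppr0 -[RHS]D1m0 /D1m /a /c; ring.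
  split=> //; transitivity (m1 0 - w 0 0 * D1m); last by rewrite m10 D1m0; ring.
  by rewrite /m1 /D10 /D1m /D0m /a /c /p /q; ring.
have D1m0 : D1m = 0.
  by apply: oppr_inj; rewrite oppr0 -[RHS]corner0 /D1m /a /c; ring.
(* For every i, m1 i - w i 0 * D1m is the determinant with rows a, w i and c; *)
(* for i = 1 and i = -1 two of these rows coincide. *)
have m1_1 : m1 1 = 0.
  transitivity (a 0 * D1m); last by rewrite D1m0 mulr0.
  by rewrite /m1 /D10 /D1m /D0m /p /q /a /c; ring.
have m1_m : m1 (-1) = 0.
  transitivity (c 0 * D1m); last by rewrite D1m0 mulr0.
  by rewrite /m1 /D10 /D1m /D0m /p /q /a /c; ring.
have m1_0 : m1 0 = 0.
  rewrite -[RHS]full0 -[RHS]addr0 -[in RHS](mulr0 (w 0 0)) -[in RHS]D1m0.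
  by rewrite /m1 /D10 /D1m /D0m /p /q /a /c; ring.
rewrite !laurentE m1_1 m1_0 m1_m /m0 /m2 D1m0 !mul0r rmorph0 !mul0r.
by rewrite !addr0 !mul0r !addr0.
Qed.

End Independent.

End Laurent.

(** * Extension of an injective morphism to the field of fractions *)

Section FractionLift.
Variables (D : idomainType) (F : fieldType) (h : {rmorphism D -> F}).
Hypothesis h_inj : forall d, h d = 0 -> d = 0.

Local Open Scope quotient_scope.

Lemma fraction_numden (z : {fraction D}) :
  z = tofrac \n_(repr z) / tofrac \d_(repr z).
Proof.
have d0 : tofrac \d_(repr z) != 0 by rewrite tofrac_eq0 denom_ratioP.
apply: (canRL (mulfK d0)); rewrite -[X in X * _]reprK.
case: (repr z) => -[n d] /= nz_d.
rewrite /= -[LHS]/(FracField.mul _ _) !piE; apply/eqmodP.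
rewrite /= FracField.equivfE /FracField.mulf !numden_Ratio ?mulr1 ?oner_eq0 //.
by rewrite mulrC.
Qed.

Lemma fraction_ind (P : {fraction D} -> Prop) :
  (forall n d, d != 0 -> P (tofrac n / tofrac d)) -> forall z, P z.
Proof. by move=> Pnd z; rewrite (fraction_numden z); apply/Pnd/denom_ratioP. Qed.

(** Written on the chosen representatives, so that rf_subst is convertible to
    an instance of it. *)
Definition fraction_lift (z : {fraction D}) : F :=
  h \n_(repr z) / h \d_(repr z).

Let h_eq0 d : (h d == 0) = (d == 0).
Proof. by apply/eqP/eqP => [/h_inj //|->]; rewrite rmorph0. Qed.

Lemma fraction_lift_div n d :
  d != 0 -> fraction_lift (tofrac n / tofrac d) = h n / h d.
Proof.
move=> d0; rewrite /fraction_lift; set z := tofrac n / tofrac d.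
have := denom_ratioP (repr z); have := fraction_numden z.
move: (\n_(repr z)) (\d_(repr z)) => n' d' zE d'0.
apply/eqP; rewrite eqr_div ?h_eq0 // -!rmorphM.
move/eqP: zE; rewrite eqr_div ?tofrac_eq0 // -!tofracM tofrac_eq.
by move/eqP <-; rewrite mulrC.
Qed.

Lemma fraction_lift_tofrac n : fraction_lift (tofrac n) = h n.
Proof.
by rewrite -[tofrac n]divr1 -tofrac1 fraction_lift_div ?oner_eq0 // rmorph1 divr1.
Qed.

Lemma fraction_lift_is_zmod_morphism : zmod_morphism fraction_lift.
Proof.
elim/fraction_ind => na da da0; elim/fraction_ind => nb db db0.
rewrite -mulNr -tofracN addf_div ?tofrac_eq0 // -!tofracM -tofracD.
rewrite !fraction_lift_div ?mulf_neq0 // -mulNr addf_div ?h_eq0 //.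
by rewrite rmorphD !rmorphM rmorphN.
Qed.

Lemma fraction_lift_is_monoid_morphism : monoid_morphism fraction_lift.
Proof.
split; first by rewrite -tofrac1 fraction_lift_tofrac rmorph1.
elim/fraction_ind => na da da0; elim/fraction_ind => nb db db0.
by rewrite mulf_div -!tofracM !fraction_lift_div ?mulf_neq0 // !rmorphM mulf_div.
Qed.

Definition fraction_lift_rmorphism : {rmorphism {fraction D} -> F} :=
  HB.pack fraction_lift
    (GRing.isZmodMorphism.Build _ _ fraction_lift fraction_lift_is_zmod_morphism)
    (GRing.isMonoidMorphism.Build _ _ fraction_lift fraction_lift_is_monoid_morphism).

End FractionLift.

(** * Counting the elements of a set through duplicate-free sequences *)

Section Cardinality.
Variable T : choiceType.

Lemma card_eq_leq_uniq (A : set T) (n : nat) (s : seq T) :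
  (A #= `I_n)%card -> uniq s -> (forall x, x \in s -> A x) -> (size s <= n)%N.
Proof.
move=> cardA uniq_s sA.
have /finite_fsetP[G GE] : finite_set A by exists n.
move: cardA; rewrite GE => /card_eq_fsetP <-.
by apply: uniq_leq_size uniq_s _ => x /sA; rewrite GE.
Qed.

Lemma card_eq_uniq (A : set T) (s : seq T) :
  uniq s -> (forall x, A x <-> x \in s) -> (A #= `I_(size s))%card.
Proof.
move=> uniq_s As; have -> : A = [set` [fset x in s]%fset]%classic.
  by apply/seteqP; split=> x /=; rewrite inE /= => /As.
by apply/card_eq_fsetP; rewrite card_fseq undup_id.
Qed.

Lemma uniq4 (e a b c : T) :
  e <> a -> e <> b -> e <> c -> a <> b -> a <> c -> b <> c ->
  uniq [:: e; a; b; c].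
Proof.
move=> *; rewrite /= !inE !negb_or -!andbA !andbT.
by do !(apply/andP; split); apply/eqP.
Qed.

Lemma mem4P (e a b c x : T) :
  x \in [:: e; a; b; c] <-> [\/ x = e, x = a, x = b | x = c].
Proof.
rewrite !inE; split=> [/or4P[] /eqP ->|[] ->]; rewrite ?eqxx ?orbT //.
- exact: Or41. - exact: Or42. - exact: Or43. - exact: Or44.
Qed.

End Cardinality.

(** * Dominant maps, their pullbacks and their composition *)

Section Pullback.
Variable R : realType.
Local Notation K := (ratfun R).
Local Notation rfC := (@rfC R).
Local Notation X := (rfX R).
Local Notation Y := (rfY R).

HB.instance Definition _ :=
  GRing.RMorphism.copy rfC (@tofrac {poly {poly R}} \o polyC \o polyC).

(** An endomorphism over R is determined by the images of x and y. *)
Lemma eval2_endo (k : {rmorphism K -> K}) (p : {poly {poly R}}) :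
  (forall c, k (rfC c) = rfC c) -> eval2 rfC (k X) (k Y) p = k (tofrac p).
Proof.
move=> kC.
have ev1 q : eval1 rfC (k Y) q = k (tofrac q%:P).
  elim/poly_ind: q => [|q c IH]; first by rewrite !rmorph0.
  rewrite polyCD polyCM !rmorphD !rmorphM /= IH eval1X eval1C.
  by rewrite -[tofrac c%:P%:P]/(rfC c) kC.
elim/poly_ind: p => [|p c IH]; first by rewrite !rmorph0.
by rewrite !rmorphD !rmorphM /= IH eval2X eval2C ev1.
Qed.

Definition dominant (g : ratmap R) : Prop := alg_independent rfC g.1 g.2.

Lemma dominant_id : dominant (ratmap_id R).
Proof.
move=> p; rewrite (eval2_endo (k := idfun)) //= => /eqP.
by rewrite tofrac_eq0 => /eqP.
Qed.

(** The endomorphism z |-> z o g of R(x, y). *)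
Definition pullback (g : ratmap R) (dom_g : dominant g) : {rmorphism K -> K} :=
  fraction_lift_rmorphism dom_g.

Section PullbackTheory.
Variables (g : ratmap R) (dom_g : dominant g).

Lemma pullback_tofrac p : pullback dom_g (tofrac p) = eval2 rfC g.1 g.2 p.
Proof. exact: fraction_lift_tofrac. Qed.

Lemma pullbackC c : pullback dom_g (rfC c) = rfC c.
Proof. by rewrite pullback_tofrac eval2C eval1C. Qed.

Lemma pullbackX : pullback dom_g X = g.1.
Proof. by rewrite pullback_tofrac eval2X. Qed.

Lemma pullbackY : pullback dom_g Y = g.2.
Proof. by rewrite pullback_tofrac eval2C eval1X. Qed.

Lemma ratmap_compE h :
  ratmap_comp h g = (pullback dom_g h.1, pullback dom_g h.2).
Proof. by []. Qed.

End PullbackTheory.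

Lemma endo_subst (k : {rmorphism K -> K}) :
  (forall c, k (rfC c) = rfC c) -> rf_subst (k X) (k Y) =1 k.
Proof.
move=> kC z; rewrite [in RHS](fraction_numden z) fmorph_div.
by congr (_ / _); exact: eval2_endo.
Qed.

Local Notation id := (ratmap_id R).
Local Notation "g ** h" := (ratmap_comp g h) (at level 40, left associativity).

Lemma ratmap_comp_id_r g : g ** id = g.
Proof.
by case: g => u v; rewrite /ratmap_comp /= !(@endo_subst idfun).
Qed.

Lemma ratmap_comp_id_l g : dominant g -> id ** g = g.
Proof.
by case: g => u v dom_g; rewrite (ratmap_compE dom_g) pullbackX pullbackY.
Qed.

(** Pulling back is contravariant: the composite of the pullbacks by g and then
    h is the endomorphism attached to g ** h.  It yields both associativity and
    the dominance of g ** h. *)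
Lemma ratmap_comp_endo g h (dom_g : dominant g) (dom_h : dominant h) :
  exists2 k : {rmorphism K -> K},
    k =1 pullback dom_h \o pullback dom_g &
    (forall c, k (rfC c) = rfC c) /\ g ** h = (k X, k Y).
Proof.
exists (pullback dom_h \o pullback dom_g) => //; split=> [c|].
  by transitivity (pullback dom_h (rfC c));
    [congr (pullback dom_h _)|]; exact: pullbackC.
by congr (_, _); congr (pullback dom_h _);
  [rewrite -(pullbackX dom_g)|rewrite -(pullbackY dom_g)].
Qed.

Lemma ratmap_compA f g h : dominant g -> dominant h ->
  f ** (g ** h) = f ** g ** h.
Proof.
move=> dom_g dom_h; have [k kE [kC ->]] := ratmap_comp_endo dom_g dom_h.
by rewrite /ratmap_comp /= !endo_subst // !kE.
Qed.

Lemma dominant_comp g h : dominant g -> dominant h -> dominant (g ** h).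
Proof.
move=> dom_g dom_h p; have [k kE [kC ->]] := ratmap_comp_endo dom_g dom_h.
rewrite /= eval2_endo // => /eqP.
by rewrite fmorph_eq0 tofrac_eq0 => /eqP.
Qed.

(** * Two commuting involutions *)

Lemma involution_prod_neq g h : dominant g -> dominant h ->
  g ** g = id -> h ** h = id -> g <> id -> h <> id -> g <> h ->
  [/\ g ** h <> id, g ** h <> g & g ** h <> h].
Proof.
move=> dg dh gg hh g1 h1 gh.
have hK k : k ** h ** h = k by rewrite -ratmap_compA // hh ratmap_comp_id_r.
have gK k : dominant k -> g ** (g ** k) = k.
  by move=> dk; rewrite ratmap_compA // gg ratmap_comp_id_l.
split => e.
- by apply: gh; rewrite -[g]hK e ratmap_comp_id_l.
- by apply: h1; rewrite -[h]gK // e gg.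
- by apply: g1; rewrite -[g]hK e hh.
Qed.

Section Involutions.
Variables a b : ratmap R.
Hypotheses (dom_a : dominant a) (dom_b : dominant b).
Hypotheses (aa : a ** a = id) (bb : b ** b = id).
Hypotheses (a1 : a <> id) (b1 : b <> id) (a_b : a <> b).

Let gen := generated [set a; b]%classic.
Let aaK g : g ** a ** a = g.
Proof. by rewrite -ratmap_compA // aa ratmap_comp_id_r. Qed.
Let bbK g : g ** b ** b = g.
Proof. by rewrite -ratmap_compA // bb ratmap_comp_id_r. Qed.

(** If a ** b and b ** a differ, then they are distinct from each other and
    from id, a and b, which makes five elements. *)
Lemma card4_commute : (gen #= `I_4)%card -> a ** b = b ** a.
Proof.
have [ab1 aba abb] := involution_prod_neq dom_a dom_b aa bb a1 b1 a_b.
have [ba1 bab baa] := involution_prod_neq dom_b dom_a bb aa b1 a1 (nesym a_b).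
have Ga : gen a by apply: gen_in; left.
have Gb : gen b by apply: gen_in; right.
move=> card4; apply: contrapT => ab_ba.
have uniq5 : uniq [:: b ** a; id; a; b; a ** b].
  rewrite cons_uniq uniq4 ?andbT //; [|exact: nesym..].
  by apply/negP => /mem4P[] // /esym.
have gen5 g : g \in [:: b ** a; id; a; b; a ** b] -> gen g.
  rewrite in_cons => /predU1P[->|/mem4P[] -> //]; first exact: gen_comp.
    exact: gen_id.
  exact: gen_comp.
by have := card_eq_leq_uniq card4 uniq5 gen5.
Qed.

(** The four elements id, a, b and a ** b form a group in which every element is
    its own inverse.  An inverse h of g, as added by gen_inv, is not known to be
    dominant; h = h ** (g ** g) = (h ** g) ** g = g requires this of g only. *)
Lemma commute_card4 : a ** b = b ** a -> (gen #= `I_4)%card.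
Proof.
move=> ab.
have [ab1 aba abb] := involution_prod_neq dom_a dom_b aa bb a1 b1 a_b.
have dom_ab := dominant_comp dom_a dom_b.
pose V g := [\/ g = id, g = a, g = b | g = a ** b].
have V1 : V id by exact: Or41.
have Va : V a by exact: Or42.
have Vb : V b by exact: Or43.
have Vab : V (a ** b) by exact: Or44.
have dom_V g : V g -> dominant g.
  by case=> ->; [exact: dominant_id|exact: dom_a|exact: dom_b|exact: dom_ab].
have sq_V g : V g -> g ** g = id.
  case=> ->; [exact: ratmap_comp_id_r|exact: aa|exact: bb|].
  by rewrite {2}ab ratmap_compA // bbK aa.
have mul_a g : V g -> V (g ** a).
  case=> ->; first by rewrite ratmap_comp_id_l //; exact: Va.
  - rewrite aa; exact: V1.
  - rewrite -ab; exact: Vab.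
  - rewrite ab aaK; exact: Vb.
have mul_b g : V g -> V (g ** b).
  case=> ->; first by rewrite ratmap_comp_id_l //; exact: Vb.
  - exact: Vab.
  - rewrite bb; exact: V1.
  - rewrite bbK; exact: Va.
have mul_V g h : V g -> V h -> V (g ** h).
  move=> Vg; case=> ->; first by rewrite ratmap_comp_id_r; exact: Vg.
  - exact: mul_a.
  - exact: mul_b.
  - by rewrite ratmap_compA //; apply/mul_b/mul_a.
apply: (@card_eq_uniq _ _ [:: id; a; b; a ** b]).
  by apply: uniq4; [exact: nesym|exact: nesym|exact: nesym|exact: a_b|
                    exact: nesym|exact: nesym].
move=> g; split=> [gen_g|/mem4P Vg].
  apply/mem4P; elim: gen_g => {g} [g [] -> //|//|g h _ Vg _ Vh|g h _ Vg gh hg].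
    exact: mul_V.
  suff -> : h = g by exact: Vg.
  rewrite -[h]ratmap_comp_id_r -(sq_V _ Vg).
  rewrite ratmap_compA; [|exact: dom_V..].
  by rewrite hg ratmap_comp_id_l //; exact: dom_V.
have Ga : gen a by apply: gen_in; left.
have Gb : gen b by apply: gen_in; right.
case: Vg => ->; [exact: gen_id|exact: Ga|exact: Gb|exact: gen_comp].
Qed.

End Involutions.

End Pullback.

(** * The group of a walk *)

Section WalkGroup.
Variables (R : realType) (W : small_step_walk R).
Hypothesis hW : nondegenerate_walk W.
Local Notation K := (ratfun R).
Local Notation rfC := (@rfC R).
Local Notation X := (rfX R).
Local Notation Y := (rfY R).
Local Notation laurent := (laurent rfC).
Local Notation "g ** h" := (ratmap_comp g h) (at level 40, left associativity).

Let transposed : int -> int -> R := fun i j => W j i.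

Let indXY : alg_independent rfC X Y := @dominant_id R.
Let indYX : alg_independent rfC Y X := alg_independent_swap indXY.

Let A1_neq0 : laurent (W 1) Y != 0. Proof. by case: hW => h *; exact: h. Qed.
Let C1_neq0 : laurent (W (-1)) Y != 0. Proof. by case: hW => _ h *; exact: h. Qed.
Let A2_neq0 : laurent (transposed 1) X != 0. Proof. by case: hW => _ _ h _; exact: h. Qed.
Let C2_neq0 : laurent (transposed (-1)) X != 0. Proof. by case: hW => _ _ _ h; exact: h. Qed.

Lemma dominant_phi1 : dominant (phi1 W).
Proof. exact: (alg_independent_laurent indXY A1_neq0 C1_neq0). Qed.

Lemma dominant_phi2 : dominant (phi2 W).
Proof.
exact: (alg_independent_swap (alg_independent_laurent indYX A2_neq0 C2_neq0)).
Qed.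

Local Notation pull1 := (pullback dominant_phi1).
Local Notation pull2 := (pullback dominant_phi2).

Let pull1Y : pull1 Y = Y. Proof. exact: (pullbackY dominant_phi1). Qed.
Let pull2X : pull2 X = X. Proof. exact: (pullbackX dominant_phi2). Qed.
Let pull1X : pull1 X = (phi1 W).1. Proof. exact: pullbackX. Qed.
Let pull2Y : pull2 Y = (phi2 W).2. Proof. exact: pullbackY. Qed.

Let pull_laurent_div g (dom_g : dominant g) a c x y :
  pullback dom_g (laurent c y / (x * laurent a y)) =
  laurent c (pullback dom_g y) / (pullback dom_g x * laurent a (pullback dom_g y)).
Proof. exact: (endo_laurent_div _ _ _ _ (pullbackC dom_g)). Qed.

Lemma phi1_involution : phi1 W ** phi1 W = ratmap_id R.
Proof.
rewrite (ratmap_compE dominant_phi1); congr (_, _); last exact: pull1Y.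
rewrite [(phi1 W).1 in LHS]/= [LHS]pull_laurent_div pull1Y pull1X.
exact: (div_div_involutive (alg_independent_neq0 indXY).1 A1_neq0 C1_neq0).
Qed.

Lemma phi2_involution : phi2 W ** phi2 W = ratmap_id R.
Proof.
rewrite (ratmap_compE dominant_phi2); congr (_, _); first exact: pull2X.
rewrite [(phi2 W).2 in LHS]/= [LHS]pull_laurent_div pull2Y pull2X.
exact: (div_div_involutive (alg_independent_neq0 indYX).1 A2_neq0 C2_neq0).
Qed.

Lemma phi1_neq_id : (phi1 W).1 <> X.
Proof. exact: (laurent_div_neq indYX A1_neq0). Qed.

Lemma phi2_neq_id : (phi2 W).2 <> Y.
Proof. exact: (laurent_div_neq indXY A2_neq0). Qed.

Lemma phi_commute_iff :
  phi1 W ** phi2 W = phi2 W ** phi1 W <->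
  corner_minor W = 0 /\ full_minor W = 0.
Proof.
have A1'_neq0 : laurent (W 1) (phi2 W).2 != 0.
  rewrite -pull2Y.
  rewrite -(endo_laurent (f := rfC) _ _ (pullbackC dominant_phi2)) fmorph_eq0.
  exact: A1_neq0.
have A2'_neq0 : laurent (transposed 1) (phi1 W).1 != 0.
  rewrite -pull1X.
  rewrite -(endo_laurent (f := rfC) _ _ (pullbackC dominant_phi1)) fmorph_eq0.
  exact: A2_neq0.
have fix1 : pull2 (phi1 W).1 = (phi1 W).1 <->
    corner_minor W = 0 /\ full_minor W = 0.
  rewrite [pull2 _]pull_laurent_div pull2X pull2Y.
  exact: (laurent_fixed_iff indXY A2_neq0 C2_neq0 A1_neq0 A1'_neq0).
have fix2 : pull1 (phi2 W).2 = (phi2 W).2 <->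
    corner_minor W = 0 /\ full_minor W = 0.
  rewrite [pull1 _]pull_laurent_div pull1X pull1Y.
  rewrite -(corner_minor_tr W) -(full_minor_tr W).
  exact: (laurent_fixed_iff (w := transposed) indYX A1_neq0 C1_neq0 A2_neq0 A2'_neq0).
rewrite (ratmap_compE dominant_phi2) (ratmap_compE dominant_phi1).
rewrite -[pull2 (phi1 W).2]/(pull2 Y) -[pull1 (phi2 W).1]/(pull1 X) pull1X pull2Y.
split=> [[e _]|minors0]; first exact/fix1.
by congr (_, _); [exact/fix1|exact/esym/fix2].
Qed.

Lemma walk_group_order4_iff :
  walk_group_has_order W 4 <-> corner_minor W = 0 /\ full_minor W = 0.
Proof.
have phi1_1 : phi1 W <> ratmap_id R by move/(congr1 fst); exact: phi1_neq_id.
have phi2_1 : phi2 W <> ratmap_id R by move/(congr1 snd); exact: phi2_neq_id.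
have phi12 : phi1 W <> phi2 W by move/(congr1 fst); exact: phi1_neq_id.
rewrite -phi_commute_iff; split.
  exact: (card4_commute dominant_phi1 dominant_phi2 phi1_involution
                        phi2_involution phi1_1 phi2_1 phi12).
exact: (commute_card4 dominant_phi1 dominant_phi2 phi1_involution
                      phi2_involution phi1_1 phi2_1 phi12).
Qed.

End WalkGroup.

(** * The determinants and the explicit form *)

Section Factorization.
Variable F : fieldType.

(** The normalization of (rho, sigma) allows a column proportional to it to be
    read off from one of its entries. *)
Lemma rank1_factor (a b c d : F) :
  a * d - b * c = 0 ->
  exists mu nu rho sigma : F,
    [/\ a = mu * rho, b = nu * rho, c = mu * sigma, d = nu * sigma
      & rho = 1 \/ rho = 0 /\ sigma = 1].
Proof.
move/eqP; rewrite subr_eq0 => /eqP ad_bc.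
have [a0|a0] := eqVneq a 0; last first.
  exists a, b, 1, (c / a); split; rewrite ?mulr1 //; last by left.
    by rewrite mulrCA divff ?mulr1.
  by rewrite mulrA -ad_bc mulrAC divff ?mul1r.
have [b0|b0] := eqVneq b 0; last first.
  exists a, b, 1, (d / b); split; rewrite ?mulr1 //; last by left.
    by rewrite mulrA ad_bc mulrAC divff ?mul1r.
  by rewrite mulrCA divff ?mulr1.
exists c, d, 0, 1; split; rewrite ?mulr1 ?mulr0 //.
by right.
Qed.

(** Once the corners are those of a rank-one matrix, the full determinant is the
    product (w 1 0 sigma - w (-1) 0 rho) (mu w 0 (-1) - nu w 0 1).
    The first factor vanishes when (w 1 0, w (-1) 0) is proportional to
    (rho, sigma), and the second one when (w 0 1, w 0 (-1)) is proportional to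
    (mu, nu). *)
Lemma minors_eq0_factor (w : int -> int -> F) :
  corner_minor w = 0 /\ full_minor w = 0 <->
  exists alpha mu nu rho sigma : F,
    [/\ w 1 1 = mu * rho, w 1 (-1) = nu * rho,
        w (-1) 1 = mu * sigma, w (-1) (-1) = nu * sigma
      & w 1 0 = alpha * rho /\ w (-1) 0 = alpha * sigma \/
        w 0 1 = mu * alpha /\ w 0 (-1) = nu * alpha].
Proof.
rewrite /corner_minor /full_minor; split; last first.
  move=> [alpha [mu [nu [rho [sigma [-> -> -> -> mid]]]]]].
  by split; [ring|case: mid => -[-> ->]; ring].
move=> [/rank1_factor[mu [nu [rho [sigma [-> -> -> -> rs]]]]] full0].
have /eqP : (w 1 0 * sigma - w (-1) 0 * rho) *
            (mu * w 0 (-1) - nu * w 0 1) = 0.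
  by rewrite -[RHS]full0; ring.
rewrite mulf_eq0 !subr_eq0 => /orP[/eqP row|/eqP col].
  have [rho1|[rho0 sigma1]] := rs.
    exists (w 1 0), mu, nu, rho, sigma; split=> //; left.
    by rewrite row rho1 !mulr1.
  exists (w (-1) 0), mu, nu, rho, sigma; split=> //; left.
  move: row; rewrite rho0 sigma1 !mulr1 !mulr0 => ->.
  by split.
have [mu0|mu0] := eqVneq mu 0; last first.
  exists (w 0 1 / mu), mu, nu, rho, sigma; split=> //; right.
  by rewrite mulrCA divff ?mulr1 // mulrA -col mulrAC divff ?mul1r.
have [nu0|nu0] := eqVneq nu 0; last first.
  exists (w 0 (-1) / nu), mu, nu, rho, sigma; split=> //; right.
  by rewrite mulrA col mulrCA divff ?mulr1 // mulrAC divff ?mul1r.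
(* All the corners vanish: rho and sigma are free, and can be taken to be the *)
(* middle entries of the outer rows. *)
exists 1, mu, nu, (w 1 0), (w (-1) 0); split; rewrite ?mu0 ?nu0 ?mul0r //.
by left; rewrite !mul1r.
Qed.

End Factorization.

Section WalkMatrices.
Variables (R : realType) (W : small_step_walk R).

Lemma det_P00 : \det (P00 W) = corner_minor W.
Proof.
rewrite (expand_det_row _ ord0) !big_ord_recl big_ord0 /cofactor !det_mx11.
by rewrite !mxE /= /corner_minor; ring.
Qed.

Lemma det_Pinfty : \det (Pinfty W) = full_minor W.
Proof.
rewrite (expand_det_row _ ord0) !big_ord_recl big_ord0 /cofactor.
rewrite !(expand_det_row _ ord0) !big_ord_recl !big_ord0 /cofactor !det_mx11.
by rewrite !mxE /= /full_minor; ring.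
Qed.

Lemma mx_of_rows3_eq (a0 a1 a2 b0 b1 b2 c0 c1 c2 : R) :
  Pinfty W = mx_of_rows 3 3 [:: [:: a0; a1; a2]; [:: b0; b1; b2]; [:: c0; c1; c2]]
  <-> [/\ [/\ W 1 1 = a0, W 1 0 = a1 & W 1 (-1) = a2],
          [/\ W 0 1 = b0, W 0 0 = b1 & W 0 (-1) = b2]
        & [/\ W (-1) 1 = c0, W (-1) 0 = c1 & W (-1) (-1) = c2]].
Proof.
split=> [/matrixP e|[[e1 e2 e3] [e4 e5 e6] [e7 e8 e9]]]; last first.
  by rewrite /Pinfty e1 e2 e3 e4 e5 e6 e7 e8 e9.
have entry (i j : 'I_3) := e i j.
have := (entry 0 0, entry 0 1, entry 0 2, entry 1 0, entry 1 1, entry 1 2,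
         entry 2 0, entry 2 1, entry 2 2).
by rewrite !mxE /= => -[[[[[[[[? ?] ?] ?] ?] ?] ?] ?] ?].
Qed.

End WalkMatrices.

Theorem theorem3p1 (R : realType) (W : small_step_walk R)
    (hW : nondegenerate_walk W) :
  (walk_group_has_order W 4 <->
     \det (P00 W) = 0 /\ \det (Pinfty W) = 0) /\
  (walk_group_has_order W 4 <->
     exists alpha mu nu rho sigma : R,
       Pinfty W = mx_of_rows 3 3
         [:: [:: mu * rho;   alpha * rho;   nu * rho];
             [:: W 0 1;      W 0 0;         W 0 (-1)];
             [:: mu * sigma; alpha * sigma; nu * sigma]] \/
       Pinfty W = mx_of_rows 3 3
         [:: [:: mu * rho;   W 1 0;    nu * rho];
             [:: mu * alpha; W 0 0;    nu * alpha];
             [:: mu * sigma; W (-1) 0; nu * sigma]]).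
Proof.
rewrite det_P00 det_Pinfty (walk_group_order4_iff hW).
split=> //; rewrite minors_eq0_factor.
split=> -[alpha [mu [nu [rho [sigma e]]]]]; exists alpha, mu, nu, rho, sigma.
  by case: e => ? ? ? ? [[? ?]|[? ?]]; [left|right]; apply/mx_of_rows3_eq.
by case: e => /mx_of_rows3_eq[[? ? ?] [? ? ?] [? ? ?]]; split=> //; [left|right].
Qed.
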